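(* Let $\mathcal C$ be a closed monoidal category admitting equalizers and coequalizers, and let $(A,\sigma)$ be a lax central commutative algebra in $\mathcal C$. If $X,Y\in\mathcal C_A^\sigma$, then the $A$-bimodule $\underline{\mathrm{Hom}}_A(X,Y)$ belongs to $\mathcal C_A^\sigma$.
   Context: A monoidal category $\mathcal C$ is closed if $X\otimes-$ and $-\otimes X$ have right adjoints for all $X$. Let $\underline{\mathrm{Hom}}(X,-)$ be the right adjoint of $-\otimes X$, with counit $\underline{\mathrm{ev}}_{X,Y}:\underline{\mathrm{Hom}}(X,Y)\otimes X\to Y$. Under the adjunction, $f:W\to\underline{\mathrm{Hom}}(X,Y)$ corresponds to its adjunct $\underline{\mathrm{ev}}_{X,Y}\circ(f\otimes\mathrm{id}_X)$. A lax half-braiding on an object $A$ is a natural transformation $\sigma_Y:A\otimes Y\to Y\otimes A$ ($Y\in\mathcal C$), not necessarily invertible, with $\sigma_{\mathbf 1}=\mathrm{id}$ and $\sigma_{Y\otimes Z}=(\mathrm{id}_Y\otimes\sigma_Z)(\sigma_Y\otimes\mathrm{id}_Z)$. A lax central commutative algebra is an algebra $(A,\mu,\eta)$ with a lax half-braiding $\sigma$ such that $\sigma_X(\mu\otimes\mathrm{id}_X)=(\mathrm{id}_X\otimes\mu)(\sigma_X\otimes\mathrm{id}_A)(\mathrm{id}_A\otimes\sigma_X)$ and $\sigma_X(\eta\otimes\mathrm{id}_X)=\mathrm{id}_X\otimes\eta$ for all $X$, and $\mu\circ\sigma_A=\mu$. $\mathcal C_A^\sigma$ is the full subcategory of the category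 ${}_A\mathcal C_A$ of $A$-bimodules consisting of those $X$ with left action $a_X^\ell$ and right action $a_X^r$ satisfying $a_X^\ell=a_X^r\circ\sigma_X$. For $X,Y\in{}_A\mathcal C_A$, $\underline{\mathrm{Hom}}(X,Y)$ is an $A$-bimodule whose left action $A\otimes\underline{\mathrm{Hom}}(X,Y)\to\underline{\mathrm{Hom}}(X,Y)$ has adjunct $a_Y^\ell\circ(\mathrm{id}_A\otimes\underline{\mathrm{ev}}_{X,Y})$ and whose right action has adjunct $\underline{\mathrm{ev}}_{X,Y}\circ(\mathrm{id}\otimes a_X^\ell)$. Then $\underline{\mathrm{Hom}}_A(X,Y)$ is the equalizer of the two morphisms $\underline{\mathrm{Hom}}(X,Y)\rightrightarrows\underline{\mathrm{Hom}}(X\otimes A,Y)$ with adjuncts $\underline{\mathrm{ev}}_{X,Y}\circ(\mathrm{id}\otimes a_X^r)$ and $a_Y^r\circ(\underline{\mathrm{ev}}_{X,Y}\otimes\mathrm{id}_A)$, with the $A$-bimodule structure making the canonical monomorphism $\underline{\mathrm{Hom}}_A(X,Y)\to\underline{\mathrm{Hom}}(X,Y)$ a bimodule map. *)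

(* Defs.v *)
From mathcomp Require Import ssreflect.

Set Implicit Arguments.
Unset Strict Implicit.
Unset Printing Implicit Defensive.

Declare Scope cat_scope.
Delimit Scope cat_scope with cat.
Local Open Scope cat_scope.

Record category := Category {
  obj :> Type;
  hom : obj -> obj -> Type;
  idm : forall X : obj, hom X X;
  comp : forall X Y Z : obj, hom Y Z -> hom X Y -> hom X Z;
  comp1m : forall (X Y : obj) (f : hom X Y), comp (idm Y) f = f;
  compm1 : forall (X Y : obj) (f : hom X Y), comp f (idm X) = f;
  compA : forall (X Y Z W : obj) (h : hom Z W) (g : hom Y Z) (f : hom X Y),
    comp h (comp g f) = comp (comp h g) f
}.

Arguments hom {c} X Y.
Arguments idm {c} X.
Arguments comp {c X Y Z} g f.

Notation "g ∘ f" := (comp g f) (at level 40, left associativity) : cat_scope.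

Record functor (C D : category) := Functor {
  fobj :> C -> D;
  fmap : forall X Y : C, hom X Y -> hom (fobj X) (fobj Y);
  fmap_id : forall X : C, fmap (idm X) = idm (fobj X);
  fmap_comp : forall (X Y Z : C) (g : hom Y Z) (f : hom X Y),
    fmap (g ∘ f) = fmap g ∘ fmap f
}.

Arguments fmap {C D} f {X Y} g : rename.

(* A functor G : D -> C together with a natural transformation
   counit : F G => id such that g |-> counit ∘ F g is a bijection
   C(W, G Y) -> D(F W, Y), with inverse transpose. *)
Record right_adjoint (C D : category) (F : functor C D) := RightAdjoint {
  radj :> functor D C;
  counit : forall Y : D, hom (F (radj Y)) Y;
  counit_nat : forall (Y Z : D) (f : hom Y Z),
    counit Z ∘ fmap F (fmap radj f) = f ∘ counit Y;
  transpose : forall (W : C) (Y : D), hom (F W) Y -> hom W (radj Y);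
  transposeK : forall (W : C) (Y : D) (f : hom (F W) Y),
    counit Y ∘ fmap F (transpose f) = f;
  counit_transpose : forall (W : C) (Y : D) (g : hom W (radj Y)),
    transpose (counit Y ∘ fmap F g) = g
}.

Record equalizer (C : category) (X Y : C) (f g : hom X Y) := Equalizer {
  eq_obj :> C;
  eq_map : hom eq_obj X;
  eq_mapE : f ∘ eq_map = g ∘ eq_map;
  eq_lift : forall (W : C) (h : hom W X), f ∘ h = g ∘ h -> hom W eq_obj;
  eq_liftE : forall (W : C) (h : hom W X) (fgh : f ∘ h = g ∘ h),
    eq_map ∘ eq_lift fgh = h;
  eq_lift_uniq : forall (W : C) (k l : hom W eq_obj),
    eq_map ∘ k = eq_map ∘ l -> k = l
}.

Record coequalizer (C : category) (X Y : C) (f g : hom X Y) := Coequalizer {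
  coeq_obj :> C;
  coeq_map : hom Y coeq_obj;
  coeq_mapE : coeq_map ∘ f = coeq_map ∘ g;
  coeq_desc : forall (W : C) (h : hom Y W), h ∘ f = h ∘ g -> hom coeq_obj W;
  coeq_descE : forall (W : C) (h : hom Y W) (hfg : h ∘ f = h ∘ g),
    coeq_desc hfg ∘ coeq_map = h;
  coeq_desc_uniq : forall (W : C) (k l : hom coeq_obj W),
    k ∘ coeq_map = l ∘ coeq_map -> k = l
}.

Definition has_equalizers (C : category) :=
  forall (X Y : C) (f g : hom X Y), equalizer f g.

Definition has_coequalizers (C : category) :=
  forall (X Y : C) (f g : hom X Y), coequalizer f g.

Record monoidal := Monoidal {
  mcat :> category;
  unit_obj : mcat;
  tens : mcat -> mcat -> mcat;
  tensm : forall X X' Y Y' : mcat,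
    hom X X' -> hom Y Y' -> hom (tens X Y) (tens X' Y');
  tensm_id : forall X Y : mcat, tensm (idm X) (idm Y) = idm (tens X Y);
  tensm_comp : forall (X X' X'' Y Y' Y'' : mcat)
      (f' : hom X' X'') (f : hom X X') (g' : hom Y' Y'') (g : hom Y Y'),
    tensm (f' ∘ f) (g' ∘ g) = tensm f' g' ∘ tensm f g;
  assoc : forall X Y Z : mcat, hom (tens (tens X Y) Z) (tens X (tens Y Z));
  assocV : forall X Y Z : mcat, hom (tens X (tens Y Z)) (tens (tens X Y) Z);
  assocVK : forall X Y Z : mcat, assoc X Y Z ∘ assocV X Y Z = idm _;
  assocK : forall X Y Z : mcat, assocV X Y Z ∘ assoc X Y Z = idm _;
  assoc_nat : forall (X X' Y Y' Z Z' : mcat)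
      (f : hom X X') (g : hom Y Y') (h : hom Z Z'),
    assoc X' Y' Z' ∘ tensm (tensm f g) h = tensm f (tensm g h) ∘ assoc X Y Z;
  lunit : forall X : mcat, hom (tens unit_obj X) X;
  lunitV : forall X : mcat, hom X (tens unit_obj X);
  lunitVK : forall X : mcat, lunit X ∘ lunitV X = idm _;
  lunitK : forall X : mcat, lunitV X ∘ lunit X = idm _;
  lunit_nat : forall (X Y : mcat) (f : hom X Y),
    lunit Y ∘ tensm (idm unit_obj) f = f ∘ lunit X;
  runit : forall X : mcat, hom (tens X unit_obj) X;
  runitV : forall X : mcat, hom X (tens X unit_obj);
  runitVK : forall X : mcat, runit X ∘ runitV X = idm _;
  runitK : forall X : mcat, runitV X ∘ runit X = idm _;
  runit_nat : forall (X Y : mcat) (f : hom X Y),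
    runit Y ∘ tensm f (idm unit_obj) = f ∘ runit X;
  pentagon : forall W X Y Z : mcat,
    tensm (idm W) (assoc X Y Z) ∘ assoc W (tens X Y) Z
      ∘ tensm (assoc W X Y) (idm Z)
    = assoc W X (tens Y Z) ∘ assoc (tens W X) Y Z;
  triangle : forall X Y : mcat,
    tensm (idm X) (lunit Y) ∘ assoc X unit_obj Y = tensm (runit X) (idm Y)
}.

Arguments unit_obj {m}.
Arguments tens {m} X Y.
Arguments tensm {m X X' Y Y'} f g.
Arguments assoc {m} X Y Z.
Arguments assocV {m} X Y Z.
Arguments lunit {m} X.
Arguments lunitV {m} X.
Arguments runit {m} X.
Arguments runitV {m} X.

Notation "X ⊗ Y" := (tens X Y) (at level 39, left associativity) : cat_scope.
Notation "f ⊠ g" := (tensm f g) (at level 39, left associativity) : cat_scope.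
Notation "𝟙" := unit_obj (at level 0) : cat_scope.

Section TensorFunctors.
Variables (C : monoidal).
Implicit Types X Y Z : C.

Lemma tensm_compl X Y Z Z' (g : hom Y Z) (f : hom X Y) :
  (g ∘ f) ⊠ idm Z' = (g ⊠ idm Z') ∘ (f ⊠ idm Z').
Proof. by rewrite -tensm_comp comp1m. Qed.

Lemma tensm_compr X Y Z Z' (g : hom Y Z) (f : hom X Y) :
  idm Z' ⊠ (g ∘ f) = (idm Z' ⊠ g) ∘ (idm Z' ⊠ f).
Proof. by rewrite -tensm_comp comp1m. Qed.

Lemma tensm_lr X X' Y Y' (f : hom X X') (g : hom Y Y') :
  (f ⊠ idm Y') ∘ (idm X ⊠ g) = f ⊠ g.
Proof. by rewrite -tensm_comp comp1m compm1. Qed.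

Lemma tensm_rl X X' Y Y' (f : hom X X') (g : hom Y Y') :
  (idm X' ⊠ g) ∘ (f ⊠ idm Y) = f ⊠ g.
Proof. by rewrite -tensm_comp comp1m compm1. Qed.

(* The functors X ⊗ - and - ⊗ X. *)
Definition tensl X : functor C C :=
  @Functor C C (fun Y => X ⊗ Y) (fun _ _ f => idm X ⊠ f)
    (fun Y => tensm_id X Y) (fun _ _ _ g f => tensm_compr X g f).

Definition tensr X : functor C C :=
  @Functor C C (fun Y => Y ⊗ X) (fun _ _ f => f ⊠ idm X)
    (fun Y => tensm_id Y X) (fun _ _ _ g f => tensm_compl X g f).

Record closed := Closed {
  closed_tensr : forall X, right_adjoint (tensr X);
  closed_tensl : forall X, right_adjoint (tensl X)
}.

End TensorFunctors.

Section InternalHom.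
Variables (C : monoidal) (HC : closed C).
Implicit Types W X Y Z : C.

(* ihom X - is right adjoint to - ⊗ X, with counit ev. *)
Definition ihom X Y : C := closed_tensr HC X Y.

Definition ev X Y : hom (ihom X Y ⊗ X) Y := counit (closed_tensr HC X) Y.

Definition adjunct W X Y (f : hom W (ihom X Y)) : hom (W ⊗ X) Y :=
  ev X Y ∘ (f ⊠ idm X).

Definition curry W X Y (f : hom (W ⊗ X) Y) : hom W (ihom X Y) :=
  @transpose _ _ _ (closed_tensr HC X) W Y f.

Lemma curryK W X Y (f : hom (W ⊗ X) Y) : adjunct (curry f) = f.
Proof. exact: (transposeK (closed_tensr HC X)). Qed.

Lemma adjunctK W X Y (f : hom W (ihom X Y)) : curry (adjunct f) = f.
Proof. exact: (@counit_transpose _ _ _ (closed_tensr HC X) W Y f). Qed.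

Lemma adjunct_inj W X Y (f g : hom W (ihom X Y)) :
  adjunct f = adjunct g -> f = g.
Proof. by move=> fg; rewrite -(adjunctK f) fg adjunctK. Qed.

Lemma adjunct_comp W W' X Y (f : hom W (ihom X Y)) (g : hom W' W) :
  adjunct (f ∘ g) = adjunct f ∘ (g ⊠ idm X).
Proof. by rewrite /adjunct tensm_compl compA. Qed.

End InternalHom.

Arguments curry {C HC W X Y} f.

Record algebra (C : monoidal) := Algebra {
  alg_obj :> C;
  mul : hom (alg_obj ⊗ alg_obj) alg_obj;
  one : hom 𝟙 alg_obj;
  mulA : mul ∘ (mul ⊠ idm alg_obj)
         = mul ∘ (idm alg_obj ⊠ mul) ∘ assoc alg_obj alg_obj alg_obj;
  mul1m : mul ∘ (one ⊠ idm alg_obj) = lunit alg_obj;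
  mulm1 : mul ∘ (idm alg_obj ⊠ one) = runit alg_obj
}.

Arguments mul {C} a.
Arguments one {C} a.

Record bimodule (C : monoidal) (A : algebra C) := Bimodule {
  bim_obj :> C;
  lact : hom (A ⊗ bim_obj) bim_obj;
  ract : hom (bim_obj ⊗ A) bim_obj;
  lactA : lact ∘ (mul A ⊠ idm bim_obj)
          = lact ∘ (idm A ⊠ lact) ∘ assoc A A bim_obj;
  lact1 : lact ∘ (one A ⊠ idm bim_obj) = lunit bim_obj;
  ractA : ract ∘ (ract ⊠ idm A)
          = ract ∘ (idm bim_obj ⊠ mul A) ∘ assoc bim_obj A A;
  ract1 : ract ∘ (idm bim_obj ⊠ one A) = runit bim_obj;
  lract : ract ∘ (lact ⊠ idm A)
          = lact ∘ (idm A ⊠ ract) ∘ assoc A bim_obj A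
}.

Arguments lact {C A} b.
Arguments ract {C A} b.

Definition is_bimodule_map (C : monoidal) (A : algebra C) (X Y : bimodule A)
    (f : hom X Y) : Prop :=
  f ∘ lact X = lact Y ∘ (idm A ⊠ f) /\ f ∘ ract X = ract Y ∘ (f ⊠ idm A).

(* In a strict monoidal category the last two axioms read sigma_1 = id and
   sigma_(Y ⊗ Z) = (id_Y ⊗ sigma_Z)(sigma_Y ⊗ id_Z); the coherence
   isomorphisms are inserted here and in lax_central_comm_algebra. *)
Record lax_half_braiding (C : monoidal) (A : C) := LaxHalfBraiding {
  lhb :> forall Y : C, hom (A ⊗ Y) (Y ⊗ A);
  lhb_nat : forall (Y Z : C) (f : hom Y Z),
    lhb Z ∘ (idm A ⊠ f) = (f ⊠ idm A) ∘ lhb Y;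
  lhb_unit : lhb 𝟙 = lunitV A ∘ runit A;
  lhb_tens : forall Y Z : C,
    lhb (Y ⊗ Z) = assocV Y Z A ∘ (idm Y ⊠ lhb Z) ∘ assoc Y A Z
                    ∘ (lhb Y ⊠ idm Z) ∘ assocV A Y Z
}.

Record lax_central_comm_algebra (C : monoidal) := LaxCentralCommAlgebra {
  lcca_alg :> algebra C;
  sigma : lax_half_braiding lcca_alg;
  sigma_mul : forall X : C,
    sigma X ∘ (mul lcca_alg ⊠ idm X)
    = (idm X ⊠ mul lcca_alg) ∘ assoc X lcca_alg lcca_alg
        ∘ (sigma X ⊠ idm lcca_alg) ∘ assocV lcca_alg X lcca_alg
        ∘ (idm lcca_alg ⊠ sigma X) ∘ assoc lcca_alg lcca_alg X;
  sigma_one : forall X : C,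
    sigma X ∘ (one lcca_alg ⊠ idm X)
    = (idm X ⊠ one lcca_alg) ∘ runitV X ∘ lunit X;
  sigma_comm : mul lcca_alg ∘ sigma lcca_alg = mul lcca_alg
}.

Arguments sigma {C} A : rename.

(* Membership of a bimodule in the full subcategory C_A^sigma. *)
Definition in_CAsigma (C : monoidal) (A : lax_central_comm_algebra C)
    (X : bimodule A) : Prop :=
  lact X = ract X ∘ sigma A X.

Section Coherence.
Variable C : monoidal.
Implicit Types W X Y Z : C.

Lemma tensm_unit_inj X Y (f g : hom X Y) :
  idm 𝟙 ⊠ f = idm 𝟙 ⊠ g -> f = g.
Proof.
move=> fg; have := f_equal (fun h => lunit Y ∘ h) fg.
rewrite !lunit_nat => h; have := f_equal (fun k => k ∘ lunitV X) h.
by rewrite -!compA lunitVK !compm1.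
Qed.

Lemma assoc_epi W X Y Z (f g : hom (X ⊗ (Y ⊗ Z)) W) :
  f ∘ assoc X Y Z = g ∘ assoc X Y Z -> f = g.
Proof.
move=> fg; have := f_equal (fun h => h ∘ assocV X Y Z) fg.
by rewrite -!compA assocVK !compm1.
Qed.

Lemma assocl_epi V W X Y Z (f g : hom ((X ⊗ (Y ⊗ Z)) ⊗ V) W) :
  f ∘ (assoc X Y Z ⊠ idm V) = g ∘ (assoc X Y Z ⊠ idm V) -> f = g.
Proof.
move=> fg; have := f_equal (fun h => h ∘ (assocV X Y Z ⊠ idm V)) fg.
by rewrite -!compA -!tensm_compl assocVK !tensm_id !compm1.
Qed.

Lemma lunit_tens X Y : lunit (X ⊗ Y) ∘ assoc 𝟙 X Y = lunit X ⊠ idm Y.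
Proof.
apply: tensm_unit_inj.
apply: (@assoc_epi _ 𝟙 (𝟙 ⊗ X) Y); apply: assocl_epi.
rewrite tensm_compr -!compA (compA (idm 𝟙 ⊠ assoc 𝟙 X Y)) pentagon compA.
rewrite triangle -{1}(tensm_id X Y) -assoc_nat.
by rewrite [in RHS]compA -assoc_nat -compA -tensm_compl triangle.
Qed.

Lemma pentagonV W X Y Z :
  (idm W ⊠ assocV X Y Z) ∘ assoc W X (Y ⊗ Z)
  = assoc W (X ⊗ Y) Z ∘ (assoc W X Y ⊠ idm Z) ∘ assocV (W ⊗ X) Y Z.
Proof.
apply: assoc_epi; rewrite -!compA assocK compm1 -pentagon.
by rewrite !compA -tensm_compr assocK tensm_id comp1m.
Qed.

Lemma assocV_nat X X' Y Y' Z Z' (f : hom X X') (g : hom Y Y') (h : hom Z Z') :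
  assocV X' Y' Z' ∘ (f ⊠ (g ⊠ h)) = ((f ⊠ g) ⊠ h) ∘ assocV X Y Z.
Proof.
apply: assoc_epi; rewrite -!compA assocK compm1 -assoc_nat.
by rewrite compA assocK comp1m.
Qed.

End Coherence.

Section HomBimodule.
Variables (C : monoidal) (HC : closed C) (A : algebra C) (X Y : bimodule A).

Local Notation H := (ihom HC X Y).
Local Notation evXY := (ev HC X Y).

Definition hom_lact : hom (A ⊗ H) H :=
  curry (lact Y ∘ (idm A ⊠ evXY) ∘ assoc A H X).

Definition hom_ract : hom (H ⊗ A) H :=
  curry (evXY ∘ (idm H ⊠ lact X) ∘ assoc H A X).

Lemma hom_lactE W (e : hom W H) :
  adjunct (hom_lact ∘ (idm A ⊠ e))
  = lact Y ∘ (idm A ⊠ adjunct e) ∘ assoc A W X.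
Proof.
rewrite adjunct_comp curryK -!compA assoc_nat (compA (idm A ⊠ evXY)).
by rewrite -tensm_compr.
Qed.

Lemma hom_ractE W (e : hom W H) :
  adjunct (hom_ract ∘ (e ⊠ idm A))
  = adjunct e ∘ (idm W ⊠ lact X) ∘ assoc W A X.
Proof.
rewrite adjunct_comp curryK -!compA assoc_nat tensm_id.
by rewrite (compA (idm H ⊠ lact X)) tensm_rl -tensm_lr !compA.
Qed.

Lemma hom_lactA :
  hom_lact ∘ (mul A ⊠ idm H) = hom_lact ∘ (idm A ⊠ hom_lact) ∘ assoc A A H.
Proof.
apply: adjunct_inj; rewrite (adjunct_comp (_ ∘ _)) hom_lactE adjunct_comp.
rewrite /hom_lact !curryK -!compA assoc_nat tensm_id.
rewrite (compA (idm A ⊠ evXY)) tensm_rl -tensm_lr !compA lactA.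
rewrite !tensm_compr -!compA; congr (_ ∘ (_ ∘ _)).
rewrite (compA (idm A ⊠ assoc A H X)) pentagon.
by rewrite compA -(tensm_id A A) assoc_nat !compA.
Qed.

Lemma hom_lact1 : hom_lact ∘ (one A ⊠ idm H) = lunit H.
Proof.
apply: adjunct_inj; rewrite adjunct_comp curryK -!compA assoc_nat tensm_id.
rewrite (compA (idm A ⊠ evXY)) tensm_rl -tensm_lr !compA lact1.
by rewrite lunit_nat -compA lunit_tens.
Qed.

Lemma hom_ractA :
  hom_ract ∘ (hom_ract ⊠ idm A) = hom_ract ∘ (idm H ⊠ mul A) ∘ assoc H A A.
Proof.
apply: adjunct_inj; rewrite hom_ractE !adjunct_comp !curryK -!compA.
rewrite (compA (assoc H A X) ((idm H ⊠ mul A) ⊠ idm X)) assoc_nat.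
rewrite !compA -!(compA evXY) -tensm_compr lactA !tensm_compr -!compA.
rewrite (compA (assoc H A X)) -tensm_id assoc_nat.
by rewrite (compA (idm H ⊠ assoc A A X)) pentagon !compA.
Qed.

Lemma hom_ract1 : hom_ract ∘ (idm H ⊠ one A) = runit H.
Proof.
apply: adjunct_inj; rewrite adjunct_comp curryK -!compA assoc_nat.
by rewrite (compA (idm H ⊠ lact X)) -tensm_compr lact1 triangle.
Qed.

Lemma hom_lract :
  hom_ract ∘ (hom_lact ⊠ idm A) = hom_lact ∘ (idm A ⊠ hom_ract) ∘ assoc A H A.
Proof.
apply: adjunct_inj; rewrite hom_ractE (adjunct_comp (_ ∘ _)) hom_lactE.
rewrite !curryK !tensm_compr -!compA; congr (_ ∘ (_ ∘ _)).
rewrite (compA (idm A ⊠ assoc H A X)) pentagon.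
by rewrite !compA -(tensm_id A H) assoc_nat.
Qed.

Definition hom_bimodule : bimodule A :=
  Bimodule hom_lactA hom_lact1 hom_ractA hom_ract1 hom_lract.

(* The parallel pair Hom(X, Y) => Hom(X ⊗ A, Y) whose equalizer is Hom_A. *)
Definition homA_fst : hom H (ihom HC (X ⊗ A) Y) :=
  curry (evXY ∘ (idm H ⊠ ract X)).

Definition homA_snd : hom H (ihom HC (X ⊗ A) Y) :=
  curry (ract Y ∘ (evXY ⊠ idm A) ∘ assocV H X A).

Lemma homA_fstE W (e : hom W H) :
  adjunct (homA_fst ∘ e) = adjunct e ∘ (idm W ⊠ ract X).
Proof.
by rewrite adjunct_comp curryK -!compA tensm_rl -tensm_lr.
Qed.

Lemma homA_sndE W (e : hom W H) :
  adjunct (homA_snd ∘ e) = ract Y ∘ (adjunct e ⊠ idm A) ∘ assocV W X A.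
Proof.
rewrite adjunct_comp curryK -!compA -tensm_id assocV_nat.
by rewrite (compA (evXY ⊠ idm A)) -tensm_compl.
Qed.

Variable E : equalizer homA_fst homA_snd.

Local Notation e := (eq_map E).

Lemma homA_adjunctE :
  adjunct e ∘ (idm E ⊠ ract X) = ract Y ∘ (adjunct e ⊠ idm A) ∘ assocV E X A.
Proof. by rewrite -homA_fstE -homA_sndE eq_mapE. Qed.

Lemma homA_lact_eq :
  homA_fst ∘ (hom_lact ∘ (idm A ⊠ e)) = homA_snd ∘ (hom_lact ∘ (idm A ⊠ e)).
Proof.
apply: adjunct_inj; rewrite homA_fstE homA_sndE hom_lactE.
move: (adjunct e) homA_adjunctE => a aE.
rewrite -!compA -(tensm_id A E) assoc_nat (compA (idm A ⊠ a)).
rewrite -tensm_compr aE !tensm_compr -!compA pentagonV.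
rewrite !tensm_compl !compA lract.
by rewrite -!compA (compA (assoc A Y A)) assoc_nat -!compA.
Qed.

Lemma homA_ract_eq :
  homA_fst ∘ (hom_ract ∘ (e ⊠ idm A)) = homA_snd ∘ (hom_ract ∘ (e ⊠ idm A)).
Proof.
apply: adjunct_inj; rewrite homA_fstE homA_sndE hom_ractE.
move: (adjunct e) homA_adjunctE => a aE.
rewrite -!compA -(tensm_id E A) assoc_nat (compA (idm E ⊠ lact X)).
rewrite -tensm_compr.
have -> : lact X ∘ (idm A ⊠ ract X) = ract X ∘ (lact X ⊠ idm A) ∘ assocV A X A.
  by rewrite lract -compA assocVK compm1.
rewrite !tensm_compr -!compA pentagonV (compA a) aE.
rewrite !tensm_compl -!compA (compA (assocV E X A)) assocV_nat -!compA.
by rewrite (compA (assocV E (A ⊗ X) A)) assocK comp1m.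
Qed.

Definition homA_lact : hom (A ⊗ E) E := eq_lift E homA_lact_eq.
Definition homA_ract : hom (E ⊗ A) E := eq_lift E homA_ract_eq.

Lemma homA_lactE : e ∘ homA_lact = hom_lact ∘ (idm A ⊠ e).
Proof. exact: eq_liftE. Qed.

Lemma homA_ractE : e ∘ homA_ract = hom_ract ∘ (e ⊠ idm A).
Proof. exact: eq_liftE. Qed.

Lemma homA_lactA :
  homA_lact ∘ (mul A ⊠ idm E) = homA_lact ∘ (idm A ⊠ homA_lact) ∘ assoc A A E.
Proof.
apply: eq_lift_uniq; rewrite !compA homA_lactE.
rewrite -!compA tensm_rl -tensm_lr compA hom_lactA.
rewrite (compA (idm A ⊠ e)) -tensm_compr homA_lactE tensm_compr -!compA.
by rewrite -(tensm_id A A) assoc_nat.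
Qed.

Lemma homA_lact1 : homA_lact ∘ (one A ⊠ idm E) = lunit E.
Proof.
apply: eq_lift_uniq; rewrite !compA homA_lactE.
by rewrite -!compA tensm_rl -tensm_lr compA hom_lact1 lunit_nat.
Qed.

Lemma homA_ractA :
  homA_ract ∘ (homA_ract ⊠ idm A) = homA_ract ∘ (idm E ⊠ mul A) ∘ assoc E A A.
Proof.
apply: eq_lift_uniq; rewrite !compA homA_ractE.
rewrite -!compA -tensm_compl homA_ractE tensm_compl compA hom_ractA.
rewrite (compA (e ⊠ idm A)) tensm_lr -!compA assoc_nat tensm_id.
by rewrite (compA (idm H ⊠ mul A)) tensm_rl.
Qed.

Lemma homA_ract1 : homA_ract ∘ (idm E ⊠ one A) = runit E.
Proof.
apply: eq_lift_uniq; rewrite !compA homA_ractE.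
by rewrite -!compA tensm_lr -tensm_rl compA hom_ract1 runit_nat.
Qed.

Lemma homA_lract :
  homA_ract ∘ (homA_lact ⊠ idm A) = homA_lact ∘ (idm A ⊠ homA_ract) ∘ assoc A E A.
Proof.
apply: eq_lift_uniq; rewrite !compA homA_ractE homA_lactE.
rewrite -!compA -tensm_compl homA_lactE tensm_compl compA hom_lract.
rewrite (compA (idm A ⊠ e)) -tensm_compr homA_ractE tensm_compr -!compA.
by rewrite assoc_nat.
Qed.

Definition homA_bimodule : bimodule A :=
  Bimodule homA_lactA homA_lact1 homA_ractA homA_ract1 homA_lract.

(* As eq_map E is monic, this property determines the two actions. *)
Lemma homA_incl_bimodule_map :
  @is_bimodule_map C A homA_bimodule hom_bimodule (eq_map E).
Proof. by split; [exact: homA_lactE | exact: homA_ractE]. Qed.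

End HomBimodule.

Definition HomA (C : monoidal) (HC : closed C) (eqC : has_equalizers C)
    (A : algebra C) (X Y : bimodule A) : bimodule A :=
  homA_bimodule (eqC _ _ (homA_fst HC X Y) (homA_snd HC X Y)).

(* Main.v *)
(* Composing with the monomorphism into Hom(X, Y) and passing to adjuncts, the
   left action on Hom_A(X, Y) becomes a^l_Y (id ⊗ a), where a is the adjunct of
   the inclusion.  As Y is in C_A^sigma, this is a^r_Y (a ⊗ id) sigma_(E ⊗ X)
   with E = Hom_A(X, Y); the hexagon splits sigma_(E ⊗ X) into sigma_E and
   sigma_X, the equalizer condition trades a^r_Y for a^r_X, and
   a^r_X sigma_X = a^l_X turns the result into the adjunct of the right action
   precomposed with sigma_E. *)
From mathcomp Require Import ssreflect.
Require Import Defs.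

Local Open Scope cat_scope.

Theorem theorem3p5 (C : monoidal) (HC : closed C) (eqC : has_equalizers C)
    (coeqC : has_coequalizers C) (A : lax_central_comm_algebra C)
    (X Y : bimodule A) (hX : in_CAsigma X) (hY : in_CAsigma Y) :
  in_CAsigma (HomA HC eqC X Y).
Proof.
rewrite /in_CAsigma /HomA /=.
set E := eqC _ _ _ _.
apply: eq_lift_uniq; rewrite compA homA_lactE homA_ractE.
(* The pattern [_ ∘ _] selects the right side only: [sigma A E] must be split off before [hom_ractE]
   applies. *)
apply: adjunct_inj; rewrite (adjunct_comp (_ ∘ _)) hom_lactE hom_ractE.
(* The remaining identity holds for any [a] from [E ⊗ X] to [Y] satisfying [aE]. *)
move: (adjunct _) (homA_adjunctE E) => a aE.
(* [assocK] cancels the associator from [hom_lactE] against the rightmost factor of [lhb_tens]. *)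
rewrite hY -!compA (compA (sigma A Y)) lhb_nat lhb_tens -!compA assocK compm1.
(* Regrouping isolates the three leftmost factors, which form the right side of [aE]. *)
rewrite (compA (a ⊠ idm A)) (compA (ract Y)) (compA (ract Y)) -aE.
by rewrite hX tensm_compr -!compA.
Qed.
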